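(* Let $(\mathbb{X},d_{\mathbb{X}})$ be a Polish metric space with bounded diameter, let $\mathcal{F}$ be a class of bounded measurable functions $\mathbb{X}\to\mathbb{R}$ such that the integral probability metric $\mathcal{I}_{\mathcal{F}}$ makes $\mathcal{P}(\mathbb{X})$ a metric space, and let $\mathcal{W}_{\mathcal{F}}$ denote the Wasserstein over $\mathcal{I}_{\mathcal{F}}$ distance. If $\mathbb{Q}_1,\mathbb{Q}_2\in\mathcal{P}(\mathcal{P}(\mathbb{X}))$ and $\tilde P_i\sim\mathbb{Q}_i$ for $i=1,2$, then $$\mathcal{I}_{\mathcal{F}}\big(\mathbb{E}(\tilde P_1),\mathbb{E}(\tilde P_2)\big)\le d_{\mathcal{F}}(\mathbb{Q}_1,\mathbb{Q}_2)\le\mathcal{W}_{\mathcal{F}}(\mathbb{Q}_1,\mathbb{Q}_2).$$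
   Context: $\mathcal{P}(\mathbb{X})$ is the space of Borel probability measures on $\mathbb{X}$ with the weak topology, and $\mathcal{P}(\mathcal{P}(\mathbb{X}))$ the space of Borel probability measures on it. $P(f)=\int f\,\mathrm{d}P$ and $\mathcal{L}(\cdot)$ denotes the law. For a random probability $\tilde P$ (random element of $\mathcal{P}(\mathbb{X})$), the mean measure $\mathbb{E}(\tilde P)\in\mathcal{P}(\mathbb{X})$ is defined by $\mathbb{E}(\tilde P)(A)=\mathbb{E}(\tilde P(A))$ for measurable $A$. $\mathcal{I}_{\mathcal{F}}(P_1,P_2)=\sup_{f\in\mathcal{F}}|P_1(f)-P_2(f)|$ for $P_1,P_2\in\mathcal{P}(\mathbb{X})$. For $\mathbb{Q}_1,\mathbb{Q}_2\in\mathcal{P}(\mathcal{P}(\mathbb{X}))$, with $\Gamma(\mathbb{Q}_1,\mathbb{Q}_2)$ the set of couplings, $$\mathcal{W}_{\mathcal{F}}(\mathbb{Q}_1,\mathbb{Q}_2)=\inf_{\gamma\in\Gamma(\mathbb{Q}_1,\mathbb{Q}_2)}\mathbb{E}_{(\tilde P_1,\tilde P_2)\sim\gamma}\big(\mathcal{I}_{\mathcal{F}}(\tilde P_1,\tilde P_2)\big)=\sup_h|\mathbb{Q}_1(h)-\mathbb{Q}_2(h)|,$$ where $h$ ranges over functions $\mathcal{P}(\mathbb{X})\to\mathbb{R}$ that are 1-Lipschitz with respect to $\mathcal{I}_{\mathcal{F}}$. The hierarchical integral probability metric is $$d_{\mathcal{F}}(\mathbb{Q}_1,\mathbb{Q}_2)=\sup_{f\in\mathcal{F}}\mathcal{W}\big(\mathcal{L}(\tilde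 P_1(f)),\mathcal{L}(\tilde P_2(f))\big),\qquad\tilde P_i\sim\mathbb{Q}_i,$$ with $\mathcal{W}$ the Wasserstein distance of order 1 on $\mathbb{R}$ with the usual distance. *)

(* Defs.v *)
From HB Require Import structures.
From mathcomp Require Import all_boot all_order all_algebra.
From mathcomp Require Import all_classical all_reals all_analysis.
From mathcomp Require Import measurable_realfun giry.

Set Implicit Arguments.
Unset Strict Implicit.
Unset Printing Implicit Defensive.

Import Order.TTheory GRing.Theory Num.Theory.
Import numFieldNormedType.Exports.

Local Open Scope classical_set_scope.
Local Open Scope ring_scope.

#[short(type="completeMetricType")]
HB.structure Definition CompleteMetric (R : numDomainType) :=
  {T of Metric R T & Complete T}.

Definition separable (T : topologicalType) :=
  exists2 S : set T, countable S & dense S.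

Definition borel (T : ptopologicalType) := g_sigma_algebraType (@open T).

Lemma continuous_borel_measurable (T : ptopologicalType) (R : realType)
  (f : T -> R) : continuous f -> measurable_fun [set: borel T] f.
Proof.
move=> /continuousP cf.
apply: (measurability _ (RGenOpens.measurableE R)).
move=> _ [_ [a [b ->] <-]]; rewrite setTI.
by apply: sub_sigma_algebra; exact/cf/interval_open.
Qed.

Section random_probability.
Context (R : realType) (X : completeMetricType R).

Definition bounded_continuous :=
  {f : X -> R | continuous f /\ bounded_fun f}.

Definition weak_eval (P : probability (borel X) R) :
    {ptws bounded_continuous -> R} :=
  fun f => \int[P]_x sval f x.

(* The weak topology: the coarsest one for which P |-> P(f) is continuous for
   every bounded continuous f. *)
Definition probs := initial_topology weak_eval.


Lemma measurable_weak_eval (f : X -> R) : continuous f -> bounded_fun f ->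
  measurable_fun [set: borel probs]
    (fun P : probability (borel X) R => \int[P]_x (f x)%:E)%E.
Proof.
move=> cf bf.
have intf (P : probability (borel X) R) :
    P.-integrable [set: borel X] (EFin \o f).
  apply: measurable_bounded_integrable => //.
  - by rewrite (le_lt_trans (probability_le1 P measurableT))// ltry.
  - exact: continuous_borel_measurable.
rewrite (_ : (fun _ => _) = EFin \o
    (fun P : probability (borel X) R => \int[P]_x f x)%R); last first.
  apply/funext => P /=; rewrite /Rintegral fineK//.
  by apply: integrable_fin_num => //; exact: intf.
apply/measurable_EFinP; apply: continuous_borel_measurable.
pose i : bounded_continuous := exist _ f (conj cf bf).
move=> P.
apply: (@continuous_comp probs {ptws bounded_continuous -> R} R weak_eval
  (fun g => g i)).
  exact: initial_continuous.
exact: (@proj_continuous {classic bounded_continuous} (fun=> R) i).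
Qed.

Lemma measurable_prob_eval (A : set X) : measurable (A : set (borel X)) ->
  measurable_fun [set: borel probs] (fun P : probability (borel X) R => P A).
Proof.
pose ev (A : set (borel X)) (P : probability (borel X) R) : \bar R := P A.
move: A; apply: (@dynkin_induction _ (borel X) open
  (fun A => measurable_fun [set: borel probs] (ev A))).
- by [].
- exact: openI.
- rewrite (_ : ev _ = cst 1%E)//.
  by apply/funext => P; rewrite /ev probability_setT.
- move=> U oU; have [->|] := eqVneq U setT.
    rewrite (_ : ev _ = cst 1%E)//.
    by apply/funext => P; rewrite /ev probability_setT.
  move=> UT.
  have /set0P[a0 Ca0] : ~` U != set0.
    by apply: contra_neq UT => /(congr1 (@setC X)); rewrite setCK setC0.
  have efin (x : X) : edist_inf (~` U) x \is a fin_num.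
    rewrite ge0_fin_numE ?edist_inf_ge0//.
    have : (edist_inf (~` U) x <= edist (x, a0))%E.
      by apply: ereal_inf_lbound; exists a0.
    move=> /le_lt_trans; apply; rewrite -ge0_fin_numE ?edist_ge0//.
    apply/edist_finP; exists (mdist x a0 + 1).
      by rewrite ltr_wpDl// mdist_ge0.
    by rewrite ballEmdist/= ltrDl.
  pose f (x : X) := fine (edist_inf (~` U) x).
  have f0 : forall t, 0 <= f t by move=> t; exact/fine_ge0/edist_inf_ge0.
  have cf : continuous f.
    move=> x; apply: fine_cvg; rewrite fineK//.
    exact: edist_inf_continuous.
  pose h n (x : X) := Num.min 1 (n%:R * f x).
  have ch n : continuous (h n).
    move=> x; apply: (@continuous_min _ _ (cst 1) (fun x => n%:R * f x)) => //.
      exact: cvg_cst.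
    by apply: cvgMr; exact: cf.
  have h01 n x : 0 <= h n x <= 1.
    by rewrite /h le_min ler01 mulr_ge0//= ge_min lexx.
  have hU x : h ^~ x @ \oo --> (\1_U x : R).
    rewrite indicE; have [|] := boolP (x \in U); rewrite ?inE ?notin_setE => Ux.
      have fx0 : 0 < f x.
        rewrite -lte_fin fineK//.
        have /nbhs_ballP[e /= e0 xeU] : nbhs x U by exact: open_nbhs_nbhs.
        rewrite (@lt_le_trans _ _ e%:E) ?lte_fin//.
        apply: le_ereal_inf_tmp => _ [a /= aU <-].
        rewrite leNgt; apply/negP => /edist_lt_ball /= xea.
        by apply: aU; exact: xeU.
      apply: cvg_near_cst; near=> n.
      apply/eqP; rewrite /h min_l// -ler_pdivrMr//.
      near: n; exact: nbhs_infty_ger.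
    rewrite (_ : h ^~ x = cst 0); first exact: cvg_cst.
    apply/funext => n; rewrite /h /f edist_inf0// fine0 mulr0 min_r//.
  pose H := fun n (P : probability (borel X) R) => (\int[P]_x (h n x)%:E)%E.
  apply: (@emeasurable_fun_cvg _ (borel probs) R setT H (ev U)).
    move=> n; apply: measurable_weak_eval; first exact: ch.
    exists 1; split; first exact: real1.
    move=> M M1 x _; case/andP: (h01 n x) => h0 h1.
    by rewrite /= ger0_norm// (le_trans h1)// ltW.
  move=> P _; rewrite /ev /H.
  have mU : measurable (U : set (borel X)) by exact: sub_sigma_algebra.
  rewrite -(setIT U) -integral_indic//.
  apply: (@dominated_cvg _ (borel X) R P setT measurableT
    (fun n x => (h n x)%:E) _ (cst 1%E)).
  - by move=> n; apply/measurable_EFinP; exact: continuous_borel_measurable.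
  - by move=> x _; apply: cvg_EFin; [exact: nearW|exact: hU].
  - by [].
  - exact: finite_measure_integrable_cst.
  - by move=> n x _; case/andP: (h01 n x) => h0 h1; rewrite /= lee_fin ger0_norm.
- move=> S mS mevS; rewrite (_ : ev _ = (fun P => 1 - ev S P)%E).
    exact: emeasurable_funB.
  by apply/funext => P; rewrite /ev probability_setC.
- move=> F mF tF mevF; rewrite (_ : ev _ =
      (fun P => limn (fun n => \sum_(0 <= i < n) ev (F i) P)%E)).
    apply: (@emeasurable_fun_cvg _ (borel probs) R setT
      (fun n P => \sum_(0 <= i < n) ev (F i) P)%E).
      by move=> n; exact: emeasurable_sum.
    move=> P _; apply: is_cvg_nneseries => n _ _; exact: measure_ge0.
  apply/funext => P; apply/esym/cvg_lim => //.
  by have FP := @measure_sigma_additive _ _ _ P F mF tF; apply FP.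
Unshelve. all: by end_near. Qed.

Definition eval_fun (f : {mfun borel X >-> R}) : borel probs -> R :=
  fun P : probability (borel X) R => \int[P]_x f x.

Lemma measurable_eval_fun (f : {mfun borel X >-> R}) :
  measurable_fun setT (eval_fun f).
Proof.
have mg (g : borel X -> \bar R) : measurable_fun setT g ->
    (forall x, 0 <= g x)%E -> measurable_fun [set: borel probs]
    (fun P : probability (borel X) R => \int[P]_x g x)%E.
  move=> mg g0.
  pose toGiry : borel probs -> giry (borel X) R :=
    fun P : probability (borel X) R => (P : subprobability (borel X) R).
  apply: (@measurableT_comp _ _ _ _ (giry (borel X) R) _ _ _ toGiry
    (measurable_giry_int mg g0)).
  by apply: measurable_giry_codensity => // A mA; exact: measurable_prob_eval.
have mf : measurable_fun setT (EFin \o f) by exact/measurable_EFinP.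
apply: (measurableT_comp (fine_measurable measurableT)).
suff: measurable_fun [set: borel probs] (fun P : probability (borel X) R =>
    \int[P]_x (EFin \o f)^\+ x - \int[P]_x (EFin \o f)^\- x)%E.
  apply: eq_measurable_fun => P _; exact/esym/integralE.
apply: emeasurable_funB; apply: mg => //.
- exact: measurable_funepos.
- exact: measurable_funeneg.
Qed.

HB.instance Definition _ (f : {mfun borel X >-> R}) :=
  isMeasurableFun.Build _ _ _ _ (eval_fun f) (measurable_eval_fun f).

Section mean_measure.
Context d (Omega : measurableType d) (Pr : probability Omega R)
  (Pt : {mfun Omega >-> borel probs}).
Local Open Scope ereal_scope.

Definition mean_measure (A : set (borel X)) : \bar R :=
  \int[Pr]_w (Pt w : probability (borel X) R) A.

Let mean_measure0 : mean_measure set0 = 0.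
Proof.
rewrite /mean_measure; under eq_integral do rewrite measure0.
exact: integral0.
Qed.

Let mean_measure_ge0 A : 0 <= mean_measure A.
Proof. by apply: integral_ge0 => w _; exact: measure_ge0. Qed.

Let mean_measure_sigma_additive : semi_sigma_additive mean_measure.
Proof.
have mPt A : measurable A ->
    measurable_fun setT (fun w => (Pt w : probability (borel X) R) A).
  move=> mA.
  exact: (measurableT_comp (measurable_prob_eval mA) (measurable_funPT Pt)).
move=> F mF tF mUF; rewrite /mean_measure.
rewrite [X in _ --> X](_ : _ = \int[Pr]_w
    \sum_(0 <= i <oo) (Pt w : probability (borel X) R) (F i)); last first.
  apply: eq_integral => w _; apply/esym/cvg_lim => //.
  by have FP := @measure_sigma_additive _ _ _
    (Pt w : probability (borel X) R) F mF tF; apply FP.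
rewrite integral_nneseries//.
- apply: is_cvg_nneseries => n _ _; exact: mean_measure_ge0.
- by move=> n; exact: mPt.
Qed.

HB.instance Definition _ := isMeasure.Build _ _ _ mean_measure
  mean_measure0 mean_measure_ge0 mean_measure_sigma_additive.

Let mean_measureT : mean_measure setT = 1.
Proof.
rewrite /mean_measure (eq_integral (cst 1)); last first.
  by move=> w _; rewrite probability_setT.
by rewrite integral_cst ?mul1e//; exact: probability_setT.
Qed.

HB.instance Definition _ := Measure_isProbability.Build _ _ _ mean_measure
  mean_measureT.

End mean_measure.

End random_probability.

Section wasserstein.
Context (R : realType).

Definition is_law d d' (T : measurableType d) (T' : measurableType d')
    (P : probability T R) (Z : {mfun T >-> T'}) (Q : probability T' R) :=
  forall A, measurable A -> distribution P Z A = Q A.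

(* The product carries the product sigma-algebra; on P(X) * P(X) this is the
   Borel sigma-algebra, P(X) being second countable. *)
Definition coupling d d' (T1 : measurableType d) (T2 : measurableType d')
    (P1 : probability T1 R) (P2 : probability T2 R) :
    set (probability (T1 * T2)%type R) :=
  [set g | (forall A, measurable A -> g (fst @^-1` A) = P1 A) /\
           (forall B, measurable B -> g (snd @^-1` B) = P2 B)].

(* When the cost is not measurable, [\int] is the lower integral: the supremum
   of the integrals of the simple functions below the cost. This is relevant to
   [wasserstein_ipm], whose cost is a supremum over an arbitrary class. *)
Definition wasserstein d (T : measurableType d) (cost : T -> T -> \bar R)
    (P1 P2 : probability T R) : \bar R :=
  ereal_inf [set (\int[g]_z cost z.1 z.2)%E | g in coupling P1 P2].

Definition wassersteinR : probability R R -> probability R R -> \bar R :=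
  wasserstein (fun x y : R => `|x - y|%:E).

End wasserstein.

Section ipm.
Context (R : realType) (X : completeMetricType R) (F : set {mfun borel X >-> R}).

Definition ipm (P1 P2 : probability (borel X) R) : \bar R :=
  ereal_sup [set `|\int[P1]_x f x - \int[P2]_x f x|%:E | f in F].

(* A [probability] is a function on all subsets, whose values outside the
   sigma-algebra are irrelevant, so that equality in P(X) is agreement on the
   Borel sets. *)
Definition ipm_metric :=
  [/\ forall P1 P2, ipm P1 P2 \is a fin_num,
      forall P1 P2, ipm P1 P2 = 0%E <->
        (forall A, measurable A -> P1 A = P2 A),
      forall P1 P2, ipm P1 P2 = ipm P2 P1 &
      forall P1 P2 P3, (ipm P1 P3 <= ipm P1 P2 + ipm P2 P3)%E].

Definition wasserstein_ipm (Q1 Q2 : probability (borel (probs X)) R) : \bar R :=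
  wasserstein (ipm : borel (probs X) -> borel (probs X) -> \bar R) Q1 Q2.

Definition hipm (Q1 Q2 : probability (borel (probs X)) R) : \bar R :=
  ereal_sup [set wassersteinR (distribution Q1 (eval_fun f))
                              (distribution Q2 (eval_fun f)) | f in F].

End ipm.

Definition bounded_diameter (R : numDomainType) (X : metricType R) :=
  exists M : R, forall x y : X, mdist x y <= M.

(* Main.v *)
Require Import Defs.
From HB Require Import structures.
From mathcomp Require Import all_boot all_order all_algebra.
From mathcomp Require Import all_classical all_reals all_analysis.
From mathcomp Require Import measurable_realfun giry.

(** Every [f] in [F] turns a probability [P] into the number [P(f)], and both
inequalities compare the random numbers [P1(f)] and [P2(f)] for one fixed [f],
the suprema over [F] being taken only at the end.

On the left, integrating [f] against the mean measure is averaging [P(f)] over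
the random [P] ([Rintegral_mean_measure]), so that [E(P1)(f) - E(P2)(f)] is the
difference of the means of the laws of [P1(f)] and [P2(f)]
([Rintegral_mean_measure_law]). A difference of means is at most the transport
cost for the usual distance, since [|E(x - y)| <= E|x - y|] under every coupling
([dist_mean_le_wassersteinR]). Boundedness of [f] provides the first moments
that this requires.

On the right, a coupling of [Q1] and [Q2] is mapped by [(P1(f), P2(f))] to a
coupling of the two laws on the line, and the cost does not increase because
[|P1(f) - P2(f)|] is bounded by the integral probability metric: this is the
contraction principle [wasserstein_distribution_le]. The metric is a supremum
over an arbitrary class and may fail to be measurable, so integrals of the cost
are lower integrals, which are still monotone ([ge0_le_lower_integral]). *)

Set Implicit Arguments.
Unset Strict Implicit.
Unset Printing Implicit Defensive.

Import Order.TTheory GRing.Theory Num.Theory.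
Import numFieldNormedType.Exports.

Local Open Scope classical_set_scope.
Local Open Scope ring_scope.

(** The integral of a nonnegative function is defined as the supremum over the
simple functions below it, and enlarging the function enlarges this family. *)
Lemma ge0_le_lower_integral d (T : measurableType d) (R : realType)
    (mu : {measure set T -> \bar R}) (f g : T -> \bar R) :
  (forall x, 0 <= f x)%E -> (forall x, f x <= g x)%E ->
  (\int[mu]_x f x <= \int[mu]_x g x)%E.
Proof.
move=> f0 fg; have g0 x : (0 <= g x)%E by exact: le_trans (f0 x) (fg x).
rewrite !ge0_integralTE//; apply: ereal_sup_le => _ [h hf <-].
by exists h => // x; exact: le_trans (hf x) (fg x).
Qed.

Lemma bounded_integrable d (T : measurableType d) (R : realType)
    (P : probability T R) (f : T -> R) :
  measurable_fun setT f -> bounded_fun f -> P.-integrable setT (EFin \o f).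
Proof.
move=> mf bf; apply: measurable_bounded_integrable => //.
by rewrite (le_lt_trans (probability_le1 P measurableT))// ltry.
Qed.

Lemma normr_Rintegral_le_bound d (T : measurableType d) (R : realType)
    (P : probability T R) (f : T -> R) (B : R) :
  measurable_fun setT f -> (forall x, `|f x| <= B) -> `|\int[P]_x f x| <= B.
Proof.
move=> mf fB.
have bf : bounded_fun f.
  exists B; split=> [|M BM x _]; first exact: num_real.
  exact: le_trans (fB x) (ltW BM).
rewrite -lee_fin EFin_normr_Rintegral//; last exact: bounded_integrable.
have mEf : measurable_fun setT (EFin \o f) by exact/measurable_EFinP.
apply: (le_trans (le_abse_integral P measurableT mEf)).
rewrite -[leRHS]mule1 -(probability_setT P); apply: integral_le_bound => //.
- by rewrite lee_fin (le_trans (normr_ge0 (f point))).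
- by apply: aeW => x _; rewrite lee_fin.
Qed.

Section coupling_transport.
Context (R : realType) (d1 d2 d1' d2' : measure_display).
Context (T1 : measurableType d1) (T2 : measurableType d2).
Context (T1' : measurableType d1') (T2' : measurableType d2').

Definition pair_mfun (X : {mfun T1 >-> T1'}) (Y : {mfun T2 >-> T2'})
  (z : T1 * T2) : T1' * T2' := (X z.1, Y z.2).

Lemma measurable_pair_mfun (X : {mfun T1 >-> T1'}) (Y : {mfun T2 >-> T2'}) :
  measurable_fun setT (pair_mfun X Y).
Proof. by apply: measurable_fun_pair => /=; exact: measurableT_comp. Qed.

HB.instance Definition _ X Y :=
  isMeasurableFun.Build _ _ _ _ (pair_mfun X Y) (measurable_pair_mfun X Y).

(** Marginals commute with coordinatewise maps. *)
Lemma coupling_distribution (P1 : probability T1 R) (P2 : probability T2 R)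
    (X : {mfun T1 >-> T1'}) (Y : {mfun T2 >-> T2'})
    (g : probability (T1 * T2)%type R) :
  coupling P1 P2 g ->
  coupling (distribution P1 X) (distribution P2 Y)
    (distribution g (pair_mfun X Y)).
Proof.
move=> [g1 g2]; split => A mA.
- apply: (g1 (X @^-1` A)).
  by rewrite -[X in measurable X]setTI; exact: (measurable_funPT X).
- apply: (g2 (Y @^-1` A)).
  by rewrite -[X in measurable X]setTI; exact: (measurable_funPT Y).
Qed.

End coupling_transport.

(** Contraction principle: a pair of statistics whose distance is dominated by
the cost transports each coupling to a coupling of the laws that is no more
expensive. *)
Lemma wasserstein_distribution_le (R : realType) d (T : measurableType d)
    (c : T -> T -> \bar R) (P1 P2 : probability T R) (X Y : {mfun T >-> R}) :
  (forall s t, `|X s - Y t|%:E <= c s t)%E ->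
  (wassersteinR (distribution P1 X) (distribution P2 Y)
     <= wasserstein c P1 P2)%E.
Proof.
move=> Xc; apply: le_ereal_inf_tmp => _ [g gP <-].
apply: (@le_trans _ _ (\int[distribution g (pair_mfun X Y)]_z
    `|z.1 - z.2|%:E)%E).
  apply: ereal_inf_lbound.
  by exists (distribution g (pair_mfun X Y)) => //; exact: coupling_distribution.
rewrite ge0_integral_distribution//; last first.
  apply/measurable_EFinP; apply: measurableT_comp => //.
  exact: measurable_funB.
by apply: ge0_le_lower_integral => z //=; exact: Xc.
Qed.

(** The easy half of Kantorovich duality, for the 1-Lipschitz function [id]. The
difference of the means can be computed on any coupling, where it is the
integral of [z.1 - z.2]. *)
Lemma dist_mean_le_wassersteinR (R : realType) (P1 P2 : probability R R) :
  P1.-integrable setT (EFin \o id) -> P2.-integrable setT (EFin \o id) ->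
  (`|\int[P1]_x x - \int[P2]_x x|%:E <= wassersteinR P1 P2)%E.
Proof.
move=> i1 i2; apply: le_ereal_inf_tmp => _ [g [g1 g2] <-].
(* each marginal is the law of a coordinate [p] under the coupling, so the
   change of variables formula carries its first moment over *)
have marginal (P : probability R R) (p : R * R -> R) :
    measurable_fun setT p -> P.-integrable setT (EFin \o id) ->
    (forall A, measurable A -> g (p @^-1` A) = P A) ->
    g.-integrable setT (EFin \o p) /\ \int[P]_x x = \int[g]_z p z.
  move=> mp iP pP.
  pose q : {mfun (R * R)%type >-> R} :=
    HB.pack p (isMeasurableFun.Build _ _ _ _ p mp).
  have ip : g.-integrable setT (EFin \o q).
    apply/integrableP; split; first exact/measurable_EFinP.
    have /integrableP[_] := iP; apply: le_lt_trans.
    rewrite [leRHS](_ : _ = \int[distribution g q]_x `|(x : R)%:E|)%E; last first.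
      by apply: eq_measure_integral => A mA _; exact/esym/pP.
    by rewrite ge0_integral_distribution//; exact: measurableT_comp.
  split=> //; congr fine.
  rewrite (@eq_measure_integral _ _ _ _ (distribution g q)); last first.
    by move=> A mA _; exact/esym/pP.
  by rewrite integral_distribution.
have [if1 ->] := marginal P1 fst measurable_fst i1 g1.
have [if2 ->] := marginal P2 snd measurable_snd i2 g2.
rewrite -RintegralB//.
have ifB : g.-integrable setT (EFin \o (fun z : R * R => z.1 - z.2)).
  by rewrite (_ : _ \o _ = (EFin \o fst) \- (EFin \o snd))%E//; exact: integrableB.
have := le_abse_integral g measurableT (measurable_int _ ifB).
by rewrite -EFin_normr_Rintegral.
Qed.

Section mean_measure_integral.
Context (R : realType) (X : completeMetricType R).
Context d (Omega : measurableType d) (Pr : probability Omega R).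
Context (Pt : {mfun Omega >-> borel (probs X)}).

(** Seen as a map into the Giry monad, the random probability makes the mean
measure a monadic bind, up to its values on nonmeasurable sets. *)
Let K (w : Omega) : giry (borel X) R :=
  (Pt w : probability (borel X) R) : subprobability (borel X) R.

Let measurable_K : measurable_fun setT K.
Proof.
apply: measurable_giry_codensity => // A mA.
exact: (measurableT_comp (measurable_prob_eval mA) (measurable_funPT Pt)).
Qed.

Lemma measurable_integral_random_prob (h : borel X -> \bar R) :
  measurable_fun setT h -> (forall x, 0 <= h x)%E ->
  measurable_fun setT
    (fun w => \int[Pt w : probability (borel X) R]_x h x)%E.
Proof.
move=> mh h0.
exact: (measurableT_comp (measurable_giry_int mh h0) measurable_K).
Qed.

(** The associativity of the Giry monad, applied to [h] instead of an
indicator. *)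
Lemma ge0_integral_mean_measure (h : borel X -> \bar R) :
  measurable_fun setT h -> (forall x, 0 <= h x)%E ->
  (\int[mean_measure Pr Pt]_x h x =
   \int[Pr]_w \int[Pt w : probability (borel X) R]_x h x)%E.
Proof.
move=> mh h0.
rewrite -[RHS](@giry_int_bind _ _ _ _ _ Pr _ measurable_K _ mh h0).
apply: eq_measure_integral => A mA _.
rewrite /giry_bind /= giry_int_map//.
exact: measurable_giry_ev.
Qed.

(** The nonnegative case is applied to the positive and negative parts of [f].
Boundedness makes all the integrals finite, so that the differences may be
recombined. *)
Lemma Rintegral_mean_measure (f : {mfun borel X >-> R}) :
  bounded_fun (f : X -> R) ->
  \int[mean_measure Pr Pt]_x f x = \int[Pr]_w eval_fun f (Pt w).
Proof.
move=> bf.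
have mf : measurable_fun setT (EFin \o f) by exact/measurable_EFinP.
have intf (P : probability (borel X) R) : P.-integrable setT (EFin \o f).
  exact: bounded_integrable.
(* each part [h] has a finite integral under the mean measure, which is the
   integral over [Omega] of the quantity claimed to be integrable *)
have int_part (h : borel X -> \bar R) : measurable_fun setT h ->
    (forall x, 0 <= h x)%E -> (forall x, h x <= `|f x|%:E)%E ->
    Pr.-integrable setT
      (fun w => \int[Pt w : probability (borel X) R]_x h x)%E.
  move=> mh h0 hf; apply/integrableP; split.
    exact: measurable_integral_random_prob.
  under eq_integral do rewrite gee0_abs ?integral_ge0//.
  rewrite -ge0_integral_mean_measure//.
  have /integrableP[_] := intf (mean_measure Pr Pt).
  by apply: le_lt_trans; apply: ge0_le_lower_integral.
have mfp := measurable_funepos mf; have mfn := measurable_funeneg mf.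
rewrite /Rintegral integralE !ge0_integral_mean_measure// -integralB//; last 2 first.
- apply: int_part => // x.
  by rewrite funeposE ge_max !lee_fin ler_norm normr_ge0.
- apply: int_part => // x.
  by rewrite funenegE ge_max -EFinN !lee_fin normr_ge0 -normrN ler_norm.
congr fine; apply: eq_integral => w _ /=.
rewrite -integralE /eval_fun fineK//.
exact: (integrable_fin_num measurableT (intf _)).
Qed.

End mean_measure_integral.

Lemma bounded_eval_fun (R : realType) (X : completeMetricType R)
    (f : {mfun borel X >-> R}) :
  bounded_fun (f : X -> R) -> bounded_fun (eval_fun f : borel (probs X) -> R).
Proof.
move=> [M [Mr fM]]; exists M; split => // B MB P _.
by apply: normr_Rintegral_le_bound => // x; exact: fM.
Qed.

(** The average of [P(f)] depends on the random probability only through its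
law, and is the mean of the image of that law on the line. *)
Lemma Rintegral_mean_measure_law (R : realType) (X : completeMetricType R)
    d (Omega : measurableType d) (Pr : probability Omega R)
    (Pt : {mfun Omega >-> borel (probs X)})
    (Q : probability (borel (probs X)) R) (f : {mfun borel X >-> R}) :
  is_law Pr Pt Q -> bounded_fun (f : X -> R) ->
  \int[mean_measure Pr Pt]_x f x = \int[distribution Q (eval_fun f)]_y y.
Proof.
move=> lawQ bf; rewrite Rintegral_mean_measure//.
have [M [Mr fM]] := bounded_eval_fun bf.
have ie : Pr.-integrable setT (EFin \o (eval_fun f \o Pt)).
  apply: bounded_integrable; first exact: measurableT_comp.
  by exists M; split => // B MB w _; exact: fM.
congr fine; rewrite integral_distribution//; last first.
  exact: (bounded_integrable Q _ (bounded_eval_fun bf)).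
rewrite -(@eq_measure_integral _ _ _ _ _ (distribution Pr Pt)); last first.
  by move=> A mA _; exact: lawQ.
by rewrite integral_distribution//; exact/measurable_EFinP.
Qed.

Lemma integrable_id_distribution_eval (R : realType) (X : completeMetricType R)
    (Q : probability (borel (probs X)) R) (f : {mfun borel X >-> R}) :
  bounded_fun (f : X -> R) ->
  (distribution Q (eval_fun f)).-integrable setT (EFin \o id).
Proof.
move=> bf; apply: integrable_pushforward => //.
  exact/measurable_EFinP.
exact: (bounded_integrable Q _ (bounded_eval_fun bf)).
Qed.

Theorem proposition3p3 (R : realType) (X : completeMetricType R)
    (sepX : separable X) (diamX : bounded_diameter X)
    (F : set {mfun borel X >-> R})
    (bndF : forall f, F f -> bounded_fun (f : X -> R))
    (metricF : ipm_metric F)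
    (Q1 Q2 : probability (borel (probs X)) R)
    (d1 d2 : measure_display)
    (Omega1 : measurableType d1) (Omega2 : measurableType d2)
    (Pr1 : probability Omega1 R) (Pr2 : probability Omega2 R)
    (Pt1 : {mfun Omega1 >-> borel (probs X)})
    (Pt2 : {mfun Omega2 >-> borel (probs X)})
    (law1 : is_law Pr1 Pt1 Q1) (law2 : is_law Pr2 Pt2 Q2) :
  (ipm F (mean_measure Pr1 Pt1) (mean_measure Pr2 Pt2) <= hipm F Q1 Q2)%E /\
  (hipm F Q1 Q2 <= wasserstein_ipm F Q1 Q2)%E.
Proof.
split; apply: ge_ereal_sup => _ [f Ff <-].
- have bf := bndF f Ff.
  rewrite (Rintegral_mean_measure_law law1 bf).
  rewrite (Rintegral_mean_measure_law law2 bf).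
  apply: (le_trans (dist_mean_le_wassersteinR _ _)).
  + exact: integrable_id_distribution_eval.
  + exact: integrable_id_distribution_eval.
  + by apply: ereal_sup_ubound; exists f.
- apply: wasserstein_distribution_le => P1 P2.
  by apply: ereal_sup_ubound; exists f.
Qed.
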